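(* Let $\mathbf{k}$ be a field, let $n\ge 0$ and $d\ge 2$ be integers, let $b$ be an integer with $0\le b\le d-1$, and let $q$ be an integer with $0\le q\le n+1-\frac{n+b}{d}$. Let $m$ and $r$ be the quotient and remainder of the division of $qd+b$ by $d-1$, i.e. $qd+b=m(d-1)+r$ with $0\le r\le d-2$. Then $$K_{p,q}(n,b;d)\neq 0$$ for every integer $p$ in the range $$\binom{m+d}{m}-\binom{m+d-r-1}{m}-m\ \le\ p\ \le\ \binom{n+d}{n}+\binom{n-m+r}{n-m}-\binom{n-m+d}{n-m}-m-1 .$$
   Context: Let $S=\mathbf{k}[x_0,\dots,x_n]$ with the standard grading, and write $S_j$ for its degree $j$ piece ($S_j=0$ for $j<0$). The group $K_{p,q}(n,b;d)$ is the cohomology at the middle term of the Koszul-type complex $$\bigwedge^{p+1}S_d\otimes_{\mathbf{k}} S_{(q-1)d+b}\longrightarrow \bigwedge^{p}S_d\otimes_{\mathbf{k}} S_{qd+b}\longrightarrow \bigwedge^{p-1}S_d\otimes_{\mathbf{k}} S_{(q+1)d+b},$$ with differentials $m_1\wedge\dots\wedge m_s\otimes g\mapsto \sum_{i=1}^{s}(-1)^{i-1}\,m_1\wedge\dots\wedge\widehat{m_i}\wedge\dots\wedge m_s\otimes m_i g$. Equivalently, it is the Koszul cohomology group of the $\operatorname{Sym}(S_d)$-module $\bigoplus_{j\in\mathbf{Z}}S_{b+jd}$, that is, $K_{p,q}(\mathbf{P}^n,\mathcal{O}_{\mathbf{P}^n}(b);\mathcal{O}_{\mathbf{P}^n}(d))$.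 Convention on binomial coefficients: when the lower entry is negative (which can occur only if $m\ge n+1$), $\binom{a}{c}=0$ for $c<0$, except that $\binom{-1}{-1}=1$. So for $m=n+1$ the coefficients $\binom{n-m+r}{n-m}$ and $\binom{n-m+d}{n-m}$ are the numbers of monomials of degree $r$, respectively $d$, in zero variables. *)

(* Defs.v *)
From HB Require Import structures.
From mathcomp Require Import all_boot all_order all_algebra.
From mathcomp Require Import boolp.
From mathcomp Require Import freeg mpoly.

Set Implicit Arguments.
Unset Strict Implicit.
Unset Printing Implicit Defensive.

Import Order.TTheory GRing.Theory Num.Theory.
Local Open Scope ring_scope.

(* The binomial coefficient vanishes for c < 0, except that it is 1 when
   a = c = -1.  The value 0 for a < 0 <= c is a default. *)
Definition binz (a c : int) : int :=
  match a, c with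
  | Posz a', Posz c' => Posz 'C(a', c')
  | Negz 0, Negz 0 => 1
  | _, _ => 0
  end.

(* The basis of S_d, for S = k[x_0, .., x_n]. *)
Definition monom (n d : nat) : finType :=
  {m : 'X_{1..n.+1 < d.+1} | mdeg m == d}.

Definition mnm n d (m : monom n d) : 'X_{1..n.+1} := bmnm (val m).

(* g \in S_j, where S_j = 0 for j < 0. *)
Definition homogz (k : fieldType) (n : nat) (j : int) (g : {mpoly k[n.+1]}) :=
  match j with
  | Posz e => g \is e.-homog
  | Negz _ => g == 0
  end.

(* \bigwedge S_d (x) S, all degrees together.  The monomials of degree d being
   totally ordered (degrevlex), e_A := m_1 /\ .. /\ m_s for A = {m_1 < .. < m_s} is a basis
   of \bigwedge S_d, and f stands for the sum over A of e_A (x) f A. *)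
Definition koszul (k : fieldType) (n d : nat) : lmodType k :=
  {ffun {set monom n d} -> {mpoly k[n.+1]}}.

Section Koszul.
Context {k : fieldType} {n d : nat}.
Local Notation S := {mpoly k[n.+1]}.
Implicit Types (A : {set monom n d}) (m u w : monom n d) (f g : koszul k n d).

Definition before m A : nat := #|[set u in A | (mnm u < mnm m)%O]|.

(* Since m sits at (0-based) position [before m A] of m |: A, this sends
   m_1 /\ .. /\ m_s (x) g with m_1 < .. < m_s to
   \sum_i (-1) ^+ i.-1 m_1 /\ .. m_i omitted .. /\ m_s (x) m_i g;
   see koszul_diff_wedge for arbitrary m_1, .., m_s in S_d. *)
Definition koszul_diff f : koszul k n d :=
  [ffun A : {set monom n d} => \sum_(m | m \notin A)
     (-1) ^+ before m A * ('X_[mnm m] * f (m |: A))].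

(* \bigwedge^p S_d (x) S_j *)
Definition koszul_chain (p j : int) : pred (koszul k n d) := fun f =>
  [forall A : {set monom n d},
    if #|A|%:Z == p then homogz j (f A) else f A == 0].

(* 1 (x) g *)
Definition wedge0 (g : S) : koszul k n d :=
  [ffun A : {set monom n d} => if A == set0 then g else 0].

(* v /\ f, from m /\ e_(A :\ m) = (-1) ^+ before m A e_A *)
Definition wedge1 (v : S) f : koszul k n d :=
  [ffun A : {set monom n d} => \sum_(m in A)
     (-1) ^+ before m A * ((v@_(mnm m))%:MP * f (A :\ m))].

(* v_1 /\ .. /\ v_s (x) g *)
Definition wedge (vs : seq S) (g : S) : koszul k n d :=
  foldr wedge1 (wedge0 g) vs.

Lemma mnm_inj : injective (@mnm n d).
Proof. by move=> u v /val_inj /val_inj. Qed.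

Lemma beforeU m u A : m \notin A ->
  before u (m |: A) = ((mnm m < mnm u)%O + before u A)%N.
Proof.
move=> mA; rewrite /before.
case: (boolP (mnm m < mnm u)%O) => [lt_mu|nlt_mu].
  have -> : [set w in m |: A | (mnm w < mnm u)%O] =
            m |: [set w in A | (mnm w < mnm u)%O].
    by apply/setP=> w; rewrite !inE; case: eqVneq => [->|//].
  by rewrite cardsU1 inE (negbTE mA).
congr #|pred_of_set _|; apply/setP=> w; rewrite !inE.
by case: eqVneq => [->|//]; rewrite (negbTE nlt_mu) !andbF.
Qed.

Lemma beforeUid m A : before m (m |: A) = before m A.
Proof.
rewrite /before; congr #|pred_of_set _|; apply/setP=> w; rewrite !inE.
by case: eqVneq => [->|//]; rewrite ltxx !andbF.
Qed.

Lemma ltmC m u : m != u -> (mnm u < mnm m)%O = ~~ (mnm m < mnm u)%O.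
Proof. by move=> ne; rewrite -leNgt lt_neqAle (inj_eq mnm_inj) eq_sym ne. Qed.

Lemma koszul_diff_is_linear : linear koszul_diff.
Proof.
move=> a f g; apply/ffunP=> A; rewrite !ffunE scaler_sumr -big_split /=.
by apply: eq_bigr => m _; rewrite !ffunE !mulrDr -!scalerAr.
Qed.

HB.instance Definition _ :=
  GRing.isLinear.Build k (koszul k n d) (koszul k n d) _ koszul_diff
    koszul_diff_is_linear.

Lemma koszul_diff_chain p j f :
  koszul_chain p j f -> koszul_chain (p - 1) (j + d%:Z) (koszul_diff f).
Proof.
move=> /forallP hf; apply/forallP=> A; rewrite ffunE.
have cU m : m \notin A -> (#|m |: A|%:Z == p) = (#|A|%:Z == p - 1).
  by move=> mA; rewrite cardsU1 mA PoszD addrC (can2_eq (addrK _) (subrK _)).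
case: ifPn => [cA|/negbTE cA]; last first.
  rewrite big1 // => m mA; move: (hf (m |: A)); rewrite cU // cA => /eqP->.
  by rewrite !mulr0.
pose T m := 'X_[mnm m] * f (m |: A).
rewrite (eq_bigr (fun m => (-1) ^+ before m A * T m)) //.
have hfT m : m \notin A -> homogz j (f (m |: A)).
  by move=> mA; move: (hf (m |: A)); rewrite cU // cA.
case: j hfT {hf} => [e|e] hfT.
  apply: rpred_sum => m mA; rewrite -signr_odd rpredMsign addnC.
  by apply: dhomogM; [rewrite dhomogX; exact: (valP m) | exact: hfT].
rewrite big1 => [|m mA]; last by rewrite /T (eqP (hfT m mA)) !mulr0.
by case: (_ + _) => e'; [exact: rpred0 | exact: eqxx].
Qed.

Lemma koszul_diff_sq f : koszul_diff (koszul_diff f) = 0.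
Proof.
apply/ffunP=> A; rewrite !ffunE.
pose F m u : S := (-1) ^+ (before m A + before u (m |: A)) *
  ('X_[mnm m] * 'X_[mnm u] * f (u |: (m |: A))).
have FC m u : m \notin A -> u \notin A -> m != u -> F m u = - F u m.
  move=> mA uA mu; rewrite /F -mulNr setUCA (mulrC 'X_[mnm m]); congr (_ * _).
  rewrite !beforeU // (ltmC mu); case: ltP => _ /=;
  by rewrite ?add0n ?add1n !(exprS, exprD) ?mulN1r ?mulrN ?mulNr ?opprK mulrC.
pose P m u := [&& m \notin A, u \notin A & (mnm m < mnm u)%O].
transitivity (\sum_m \sum_(u | P m u) (F m u + F u m)); last first.
  rewrite big1 // => m _; rewrite big1 // => u /and3P[mA uA lt_mu].
  by rewrite (FC m) ?addNr //; apply: contraTneq lt_mu => ->; rewrite ltxx.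
under [RHS]eq_bigr do rewrite big_split /=.
rewrite big_split /= [X in _ + X](exchange_big_dep xpredT) //= -big_split /=.
rewrite big_mkcond; apply: eq_bigr => m _; rewrite ffunE.
case: ifPn => [mA|mA]; last first.
  by rewrite !big_pred0 ?addr0 // => u; rewrite /P (negbTE mA) ?andbF.
rewrite !mulr_sumr (bigID (fun u => mnm m < mnm u)%O) /=; congr (_ + _).
  apply: eq_big => [u|u _]; last by rewrite /F exprD [X in _ * X]mulrCA !mulrA.
  rewrite /P mA /= !inE negb_or.
  by case: (eqVneq u m) => [->|//]; rewrite ltxx !andbF.
apply: eq_big => [u|u _]; last by rewrite /F exprD [X in _ * X]mulrCA !mulrA.
rewrite /P mA /= !inE negb_or; case: (eqVneq u m) => [->|um] /=.
  by rewrite ltxx andbF.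
by rewrite (ltmC um) negbK.
Qed.

Lemma mpolySdE (v : S) : v \is d.-homog ->
  v = \sum_(m : monom n d) (v@_(mnm m))%:MP * 'X_[mnm m].
Proof.
move=> hv.
have sv : (msize v <= d.+1)%N.
  by rewrite msizeE; apply/bigmax_leqP_seq => m /(dhomog_mf hv) ->.
rewrite {1}(mpolywE sv).
rewrite (bigID [pred m : 'X_{1..n.+1 < d.+1} | mdeg m == d]) /=.
rewrite addrC big1 ?add0r => [|m md]; last first.
  by rewrite (dhomog_nemf_coeff hv md) scale0r.
rewrite (big_sub [pred m : 'X_{1..n.+1 < d.+1} | mdeg m == d]).
by apply: eq_bigr => m _; rewrite mul_mpolyC.
Qed.

Lemma koszul_diff_wedge0 (g : S) : koszul_diff (wedge0 g) = 0.
Proof.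
apply/ffunP=> A; rewrite !ffunE big1 // => m _; rewrite ffunE.
rewrite (_ : _ == _ = false) ?mulr0 //.
by apply/negbTE/set0Pn; exists m; rewrite setU11.
Qed.

Lemma koszul_diff_wedge1 (v : S) f : v \is d.-homog ->
  koszul_diff (wedge1 v f) =
    [ffun A : {set monom n d} => v * f A] - wedge1 v (koszul_diff f).
Proof.
move=> hv; apply/ffunP=> A; rewrite !ffunE.
apply/eqP; rewrite -subr_eq opprK; apply/eqP.
pose F m u : S := (-1) ^+ (before m A + before u (m |: A)) *
  ((v@_(mnm u))%:MP * 'X_[mnm m] * f (m |: (A :\ u))).
have D1 m : m \notin A ->
    (-1) ^+ before m A * ('X_[mnm m] * wedge1 v f (m |: A)) =
    (v@_(mnm m))%:MP * 'X_[mnm m] * f A + \sum_(u in A) F m u.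
  move=> mA; rewrite ffunE big_setU1 //= beforeUid setU1K // !mulrDr.
  congr (_ + _).
    by rewrite [X in _ * X]mulrCA signrMK mulrA (mulrC 'X_[_]).
  rewrite !mulr_sumr; apply: eq_bigr => u uA.
  have mu : m != u by apply: contraNneq mA => ->.
  rewrite /F exprD (_ : (m |: A) :\ u = m |: (A :\ u)); last first.
    by apply/setP=> w; rewrite !inE; case: (eqVneq w m) => [->|]; rewrite ?mu.
  by rewrite [X in _ * X]mulrCA !mulrA; congr (_ * _); rewrite mulrAC.
have D2 u : u \in A ->
    (-1) ^+ before u A * ((v@_(mnm u))%:MP * koszul_diff f (A :\ u)) =
    (v@_(mnm u))%:MP * 'X_[mnm u] * f A - \sum_(m | m \notin A) F m u.
  move=> uA; rewrite ffunE (bigD1 u) ?setD11 //= setD1K // !mulrDr.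
  congr (_ + _).
    rewrite -{1}(setD1K uA) beforeUid.
    by rewrite [X in _ * X]mulrCA signrMK mulrA.
  rewrite !mulr_sumr -sumrN; apply: eq_big => [m|m mAu].
    by rewrite !inE; case: eqVneq => [->|]; rewrite ?uA ?andbF ?andbT.
  have [mA mu] := andP mAu; rewrite /F; set B := A :\ u in mA *.
  have uB : u \notin B by rewrite setD11.
  rewrite -(setD1K uA) -/B setUCA !beforeUid !beforeU // (ltmC mu).
  rewrite [X in _ * X = _]mulrCA !mulrA -exprD -!mulNr; congr (_ * _ * _ * _).
  by case: ltP => _ /=; rewrite ?add0n ?add1n !(exprS, exprD) ?addnS ?exprS
    ?mulN1r ?mulrN ?mulNr ?opprK ?exprD mulrC.
rewrite (eq_bigr _ D1) (eq_bigr _ D2) !big_split /= sumrN exchange_big /=.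
rewrite addrACA subrr addr0 addrC [X in _ = X * _](mpolySdE hv) mulr_suml.
by rewrite [RHS](bigID (mem A)).
Qed.

Lemma wedge1_sum (v : S) (I : finType) (F : I -> koszul k n d) (a : I -> nat) :
  wedge1 v (\sum_i (-1) ^+ a i *: F i) = \sum_i (-1) ^+ a i *: wedge1 v (F i).
Proof.
apply/ffunP=> A; rewrite sum_ffunE !ffunE.
under [RHS]eq_bigr do rewrite !ffunE scaler_sumr.
rewrite exchange_big /=; apply: eq_bigr => m mA.
rewrite sum_ffunE !mulr_sumr; apply: eq_bigr => i _.
by rewrite !ffunE !scalerAr.
Qed.

Lemma wedgeM (v g : S) vs :
  wedge vs (v * g) = [ffun A : {set monom n d} => v * wedge vs g A].
Proof.
elim: vs => [|w vs IH] /=; apply/ffunP=> A; rewrite !ffunE.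
  by case: ifP; rewrite ?mulr0.
rewrite mulr_sumr; apply: eq_bigr => m mA.
by rewrite IH ffunE 2!(mulrCA v).
Qed.

Lemma koszul_diff_wedge (vs : seq S) (g : S) :
    {in vs, forall v, v \is d.-homog} ->
  koszul_diff (wedge vs g) =
    \sum_(i < size vs)
       (-1) ^+ i *: wedge (take i vs ++ drop i.+1 vs) (vs`_i * g).
Proof.
elim: vs => [|v vs IH] hvs /=; first by rewrite big_ord0 koszul_diff_wedge0.
rewrite koszul_diff_wedge1 ?hvs ?mem_head // IH => [|w wvs]; last first.
  by rewrite hvs // inE wvs orbT.
rewrite big_ord_recl /= expr0 scale1r drop0 wedgeM wedge1_sum -sumrN.
by congr (_ + _); apply: eq_bigr => i _; rewrite exprS mulN1r scaleNr.
Qed.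

Section Homology.
Variables (b p q : int).

(* The middle term of the complex is \bigwedge^p S_d (x) S_(qd+b). *)
Definition koszul_cycle : pred (koszul k n d) := fun z =>
  koszul_chain p (q * d%:Z + b) z && (koszul_diff z == 0).

Lemma homogz_zmod_closed j : zmod_closed (@homogz k n j).
Proof.
case: j => e; split=> [|g h]; rewrite /in_mem /= ?rpred0 //.
- exact: rpredB.
- by move=> /eqP-> /eqP->; rewrite subrr.
Qed.

Lemma koszul_chain_zmod_closed r j : zmod_closed (koszul_chain r j).
Proof.
have [h0 hB] := homogz_zmod_closed j.
split=> [|f g /forallP hf /forallP hg]; apply/forallP => A; rewrite !ffunE.
  by case: ifP => _; [exact: h0 | exact: eqxx].
move: (hf A) (hg A); case: ifP => _; first exact: hB.
by move=> /eqP-> /eqP->; rewrite subrr.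
Qed.

Lemma koszul_cycle_zmod_closed : zmod_closed koszul_cycle.
Proof.
have [c0 cB] := koszul_chain_zmod_closed p (q * d%:Z + b).
split=> [|f g /andP[hf /eqP df] /andP[hg /eqP dg]]; apply/andP; split.
- exact: c0.
- by rewrite linear0.
- exact: cB.
- by rewrite linearB /= df dg subrr.
Qed.

HB.instance Definition _ :=
  GRing.isZmodClosed.Build (koszul k n d) koszul_cycle koszul_cycle_zmod_closed.

Record koszul_cycles := KoszulCycle {
  cycle_val :> koszul k n d;
  _ : cycle_val \in koszul_cycle
}.

HB.instance Definition _ := [isSub for cycle_val].
HB.instance Definition _ := [Choice of koszul_cycles by <:].
HB.instance Definition _ := [SubChoice_isSubZmodule of koszul_cycles by <:].

Definition koszul_boundary : pred koszul_cycles := fun z =>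
  `[< exists2 w, koszul_chain (p + 1) ((q - 1) * d%:Z + b) w &
        cycle_val z = koszul_diff w >].

Lemma koszul_boundary_zmod_closed : zmod_closed koszul_boundary.
Proof.
have [c0 cB] := koszul_chain_zmod_closed (p + 1) ((q - 1) * d%:Z + b).
split=> [|y z /asboolP[v hv ey] /asboolP[w hw ez]]; apply/asboolP.
  exists 0; first exact: c0.
  by rewrite linear0.
exists (v - w); first exact: cB.
by rewrite linearB /= -ey -ez.
Qed.

HB.instance Definition _ :=
  GRing.isZmodClosed.Build koszul_cycles koszul_boundary
    koszul_boundary_zmod_closed.

(* K_{p,q}(n, b; d) *)
Definition koszul_cohomology : zmodType :=
  Quotient.quot (GRing.ZmodClosed.clone koszul_cycles koszul_boundary _).

Lemma koszul_cohomology_neq0 :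
  (exists x : koszul_cohomology, x != 0) <->
  (exists2 z, z \in koszul_cycle &
     ~ exists2 w, koszul_chain (p + 1) ((q - 1) * d%:Z + b) w &
         z = koszul_diff w).
Proof.
pose I := GRing.ZmodClosed.clone koszul_cycles koszul_boundary _.
have E z : (\pi_(Quotient.quot I)%qT z == 0) = koszul_boundary z.
  by rewrite -(raddf0 (\pi_(Quotient.quot I)%qT)) -Quotient.idealrBE subr0.
split=> [[x x0]|[z hz nz]].
  exists (cycle_val (repr x)); first by case: (repr x).
  by move=> /asboolP; rewrite -[X in is_true X]E reprK (negbTE x0).
exists (\pi_(Quotient.quot I)%qT (KoszulCycle hz)).
by rewrite E; apply/asboolP.
Qed.

End Homology.
End Koszul.

Arguments koszul_cycles : clear implicits.
Arguments koszul_cohomology : clear implicits.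

(* Main.v *)
Require Import Defs.
From mathcomp Require Import all_boot all_order all_algebra.
From mathcomp Require Import mpoly.
From mathcomp Require Import zify ring.

(** A single monomial cycle gives a nonzero class.  Let
    f = x_0^(d-1) .. x_(m-1)^(d-1) x_m^r, of degree q d + b.  Modulo the powers
    x_j^d, a monomial u of degree d kills f exactly when f_j + u_j >= d for
    some j, so over S / (x_0^d, .., x_n^d) the element e_A (x) f is a cycle for
    every set A of such monomials u.  If moreover A contains every divisor of f
    of degree d, then it is not a boundary: a term e_(A + u) (x) g of a chain
    contributes to e_A (x) f only if u g involves f, and then u divides f, so
    that u already lies in A.

    As the x_j^d form a regular sequence, the two Koszul complexes, over S and
    over the quotient, have the same cohomology; but only a lift of e_A (x) f
    to a cycle over S is needed, and it has a closed form.  Choose for each u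
    in A an index j(u) with f_j(u) + u_j(u) >= d.  Over Laurent polynomials
    each u (x) 1 - x_j(u)^d (x) u / x_j(u)^d is a cycle, hence so is their
    wedge product times f.  Expanding it, two replacements with the same index
    j cancel since x_j^d /\ x_j^d = 0, so in each surviving term x_j^d is
    divided out at most once, and f u_1 u_2 .. has enough x_j to allow it: the
    product has polynomial coefficients.  It is built here with denominators
    cleared ([swaps]); [swaps_divisible] is the divisibility that allows
    dividing them out again ([lift]), and [koszul_cohomology_monomial] is the
    resulting nonvanishing criterion.  No pure power x_j^d lies in A, so the
    coefficient of e_A in the lift is still f, up to sign, and the argument
    against boundaries applies to it directly over S.

    The bounds on p are then the numbers of admissible monomials: the divisors
    of f of degree d ([card_divisors]) and the monomials other than pure powers
    that kill f ([card_annihilators], [card_annihilators_full]).  Every p in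
    between is the size of a set A squeezed between these two.  The divisors,
    and the monomials that do not kill f, are both described by bounding one
    exponent among s + 1 variables and excluding pure powers, which
    [card_bounded] counts.  When f does not exist, because m (d-1) + r exceeds
    (n+1) (d-1), the range of p is empty. *)

Import Order.TTheory GRing.Theory Num.Theory.
Local Open Scope ring_scope.

Set Implicit Arguments.
Unset Strict Implicit.
Unset Printing Implicit Defensive.

(** * Monomials of degree d *)

Section Monomials.
Context {n d : nat}.

Lemma mdeg_mnm (u : monom n d) : mdeg (mnm u) = d.
Proof. exact: (eqP (valP u)). Qed.

Lemma mnm_exists (a : 'X_{1..n.+1}) : mdeg a = d ->
  exists u : monom n d, mnm u == a.
Proof.
move=> ha; have lt_a : (mdeg a < d.+1)%N by rewrite ha.
have da : mdeg (BMultinom lt_a) == d by apply/eqP.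
by exists (Sub (BMultinom lt_a) da); rewrite /mnm SubK.
Qed.

Definition to_monom (a : 'X_{1..n.+1}) (ha : mdeg a = d) : monom n d :=
  xchoose (mnm_exists ha).

Lemma to_monomE a (ha : mdeg a = d) : mnm (to_monom ha) = a.
Proof. exact: eqP (xchooseP (mnm_exists ha)). Qed.

Lemma mdeg_var_pow (j : 'I_n.+1) : mdeg (U_(j) *+ d)%MM = d.
Proof. by rewrite mdegMn mdeg1 mul1n. Qed.

Definition var_pow (j : 'I_n.+1) : monom n d := to_monom (mdeg_var_pow j).

Lemma var_powE j i : mnm (var_pow j) i = ((j == i) * d)%N.
Proof. by rewrite to_monomE mulmnE mnm1E. Qed.

Lemma var_pow_inj : (0 < d)%N -> injective var_pow.
Proof.
move=> d_gt0 i j /(congr1 (fun u => mnm u j)); rewrite !var_powE eqxx mul1n.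
by case: eqVneq => // _ d0; rewrite -d0 in d_gt0.
Qed.

Lemma var_powP (u : monom n d) j : (d <= mnm u j)%N -> u = var_pow j.
Proof.
move=> du; apply: mnm_inj; apply/mnmP=> i; rewrite var_powE.
have := mdeg_mnm u; rewrite mdegE (bigD1 j) //= => E.
case: eqVneq => [<-|ji]; first by lia.
move: E; rewrite (bigD1 i) 1?eq_sym //= => E; lia.
Qed.

Lemma card_monom : #|monom n d| = 'C(n + d, n).
Proof.
rewrite -bin_sub ?leq_addr // addKn addnC -size_basis cardE -(size_map (@mnm n d)).
apply/perm_size/uniq_perm; rewrite ?uniq_basis //.
  by rewrite (map_inj_uniq (@mnm_inj _ _)) enum_uniq.
move=> a; rewrite -basis_cover; apply/mapP/eqP => [[u _ ->]|ha].
  exact: mdeg_mnm.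
by exists (to_monom ha); rewrite ?mem_enum ?to_monomE.
Qed.

End Monomials.

(** * Division of polynomials by a monomial *)

Section MonomialDivision.
Context {k : fieldType} {n : nat}.
Local Notation S := {mpoly k[n.+1]}.
Implicit Types (p : S) (a c : 'X_{1..n.+1}).

(** The subtraction of exponents is truncated, so this is the quotient of p by
    'X_[c] only when c divides every monomial of p. *)
Definition mnm_div c p : S := \sum_(a <- msupp p) p@_a *: 'X_[a - c].

Lemma mnm_divK c p : {in msupp p, forall a, (c <= a)%MM} ->
  'X_[c] * mnm_div c p = p.
Proof.
move=> cp; rewrite [RHS]mpolyE mulr_sumr; apply: eq_big_seq => a /cp ca.
by rewrite -scalerAr -mpolyXD addmC submK.
Qed.

Lemma mnm_div_homog c p e : {in msupp p, forall a, (c <= a)%MM} ->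
  p \is (mdeg c + e).-homog -> mnm_div c p \is e.-homog.
Proof.
move=> cp /dhomogP hp; rewrite /mnm_div big_seq; apply: rpred_sum => a ap.
apply: rpredZ; rewrite dhomogX; apply/eqP.
by have := hp a ap; rewrite -{1}(submK (cp a ap)) /= mdegD; lia.
Qed.

Lemma mnm_div0 c : mnm_div c 0 = 0.
Proof. by rewrite /mnm_div msupp0 big_nil. Qed.

Lemma mpolyX_eq0 c : ('X_[c] == 0 :> S) = false.
Proof. by rewrite -msupp_eq0 msuppX. Qed.

Lemma mem_msuppXM c p a : a \in msupp ('X_[c] * p) ->
  exists2 a', a' \in msupp p & a = (c + a')%MM.
Proof. by rewrite mulrC (perm_mem (msuppMX p c)) => /mapP[a' ? ->]; exists a'. Qed.

Lemma mem_msupp_sign e p : msupp ((-1) ^+ e * p) =i msupp p.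
Proof.
move=> a; rewrite -signr_odd; case: odd; rewrite ?expr0 ?mul1r //.
by rewrite expr1 mulN1r (perm_mem (msuppN p)).
Qed.

Lemma mcoeffXM_eq0 c p a : ~~ (c <= a)%MM -> ('X_[c] * p)@_a = 0.
Proof.
move=> nca; apply/eqP; rewrite mcoeff_eq0; apply: contra nca.
by move/mem_msuppXM=> [a' _ ->]; exact: lem_addr.
Qed.

End MonomialDivision.

(** * Lifting a monomial cycle from the truncated ring *)

Section Lift.
Context {k : fieldType} {n d : nat}.
Local Notation S := {mpoly k[n.+1]}.
Implicit Types (A C : {set monom n d}) (u m : monom n d) (g : koszul k n d).

Definition smul (c : S) g : koszul k n d :=
  [ffun A : {set monom n d} => c * g A].

Lemma koszul_diff_smul c g : koszul_diff (smul c g) = smul c (koszul_diff g).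
Proof.
apply/ffunP=> A; rewrite !ffunE mulr_sumr; apply: eq_bigr => m _.
by rewrite ffunE; ring.
Qed.

Lemma wedge1XE u g A : wedge1 'X_[mnm u] g A =
  if u \in A then (-1) ^+ before u A * g (A :\ u) else 0.
Proof.
have E m : m != u -> ('X_[mnm u] : S)@_(mnm m) = 0.
  by move=> mu; rewrite mcoeffX (inj_eq (@mnm_inj _ _)) eq_sym (negbTE mu).
rewrite ffunE; case: ifPn => uA.
  rewrite (bigD1 u) //= big1 ?addr0 => [|m /andP[_ mu]].
    by rewrite mcoeffX eqxx mpolyC1 mul1r.
  by rewrite E // mpolyC0 mul0r mulr0.
rewrite big1 // => m mA; rewrite E ?mpolyC0 ?mul0r ?mulr0 //.
by apply: contraNneq uA => <-.
Qed.

(** Left multiplication by m * (u (x) 1) - u * (m (x) 1), which is u (x) 1 minus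
    m (x) u / m with the denominator m cleared.  Its differential m u - u m
    vanishes, hence [koszul_diff_swap]. *)
Definition swap u m g : koszul k n d :=
  smul 'X_[mnm m] (wedge1 'X_[mnm u] g) - smul 'X_[mnm u] (wedge1 'X_[mnm m] g).

Lemma swapE u m g A : swap u m g A =
  'X_[mnm m] * wedge1 'X_[mnm u] g A - 'X_[mnm u] * wedge1 'X_[mnm m] g A.
Proof. by rewrite !ffunE. Qed.

Lemma koszul_diff_swap u m g :
  koszul_diff (swap u m g) = - swap u m (koszul_diff g).
Proof.
have hX (v : monom n d) : ('X_[mnm v] : S) \is d.-homog.
  by rewrite dhomogX; exact: (valP v).
rewrite /swap linearB /= !koszul_diff_smul !koszul_diff_wedge1 //.
apply/ffunP=> A; rewrite !ffunE; ring.
Qed.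

Hypothesis d_gt0 : (0 < d)%N.
Variables (f : 'X_{1..n.+1}) (J : monom n d -> 'I_n.+1).

(** J u is the index of the variable whose d-th power divides f u; swaps s is
    then the product of all u (x) 1 - x_(J u)^d (x) u / x_(J u)^d, times f and
    times the common denominator [denom s]. *)
Definition swaps (s : seq (monom n d)) : koszul k n d :=
  foldr (fun u => swap u (var_pow (J u))) (wedge0 'X_[f]) s.

Definition denom (s : seq (monom n d)) : 'X_{1..n.+1} :=
  (\sum_(u <- s) mnm (@var_pow n d (J u)))%MM.

Lemma koszul_diff_swaps s : koszul_diff (swaps s) = 0.
Proof.
elim: s => [|u s IH] /=; first exact: koszul_diff_wedge0.
rewrite koszul_diff_swap IH; apply/ffunP=> A.
by rewrite ffunE swapE !wedge1XE !ffunE !mulr0 !if_same !mulr0 subrr oppr0.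
Qed.

Lemma mdeg_denom s : mdeg (denom s) = (d * size s)%N.
Proof.
rewrite /denom mdeg_sum (eq_bigr (fun _ => d)) => [|u _]; last exact: mdeg_mnm.
by rewrite big_const_seq count_predT iter_addn_0.
Qed.

Lemma swaps_homog s C :
  swaps s C \is (d * size s + mdeg f).-homog /\
  (#|C| != size s -> swaps s C = 0).
Proof.
elim: s C => [|u s IH] C /=.
  rewrite ffunE muln0 add0n cards_eq0; case: eqP => _.
    by split=> //; rewrite dhomogX.
  by split=> // ; rewrite rpred0.
have hW (v m : monom n d) :
    'X_[mnm m] * wedge1 'X_[mnm v] (swaps s) C
      \is (d * (size s).+1 + mdeg f).-homog /\
    (#|C| != (size s).+1 -> 'X_[mnm m] * wedge1 'X_[mnm v] (swaps s) C = 0).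
  rewrite wedge1XE; case: ifPn => vC; last by rewrite mulr0 rpred0.
  have [IH1 IH2] := IH (C :\ v).
  split=> [|cC]; last by rewrite IH2 ?mulr0 //; rewrite (cardsD1 v) vC in cC.
  rewrite mulnS -addnA; apply: dhomogM; first by rewrite dhomogX; exact: (valP m).
  by rewrite -signr_odd rpredMsign.
rewrite swapE; have [h1 z1] := hW u (var_pow (J u)).
have [h2 z2] := hW (var_pow (J u)) u.
by split=> [|cC]; [exact: rpredB | rewrite z1 ?z2 ?subrr].
Qed.

(** Besides the choice of J, pure powers are excluded: they would mix with the
    wedge factors x_j^d that the swaps introduce. *)
Definition liftable (s : seq (monom n d)) := {in s, forall u,
  (forall j, mnm u j < d)%N /\ (d <= f (J u) + mnm u (J u))%N}.

Lemma denomE s j : denom s j = (d * count (fun u => J u == j) s)%N.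
Proof.
rewrite mnm_sumE; elim: s => [|u s IH]; first by rewrite big_nil muln0.
by rewrite big_cons IH var_powE /= mulnDr mulnC.
Qed.

(** The divisibility of swaps s by its denominator needs to be strengthened to
    go through the induction.  As long as x_j^d is not among the wedge factors
    C, no denominator x_j^d has been used, and all of f_j is still available.
    Bringing in x_j^d for u uses one denominator, and f_j + u_j >= d pays for
    it.  This happens at most once for each j, as x_j^d would be repeated. *)
Lemma swaps_divisible s C : liftable s ->
  {in msupp (swaps s C), forall (a : 'X_{1..n.+1}) j,
    (denom s j + (var_pow j \notin C) * f j <= a j)%N}.
Proof.
elim: s C => [|u s IH] C hs a.
  rewrite ffunE; case: eqP => [->|_]; last by rewrite msupp0.
  rewrite msuppX inE => /eqP-> j; rewrite denomE muln0 inE mul1n; lia.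
have [u_nv du] := hs u (mem_head _ _).
have {}IH C' := IH C' (fun v vs => hs v (mem_behead (s := u :: s) vs)).
have nu j : u != var_pow j.
  by apply/eqP=> E; have := u_nv j; rewrite E var_powE eqxx; lia.
rewrite swapE => /msuppB_le; rewrite mem_cat => /orP[] /mem_msuppXM[a' ];
  rewrite wedge1XE; case: ifPn => vC; rewrite ?msupp0 // mem_msupp_sign;
  move=> /IH ha' -> j; have := ha' j; rewrite !denomE mnmDE !inE /= mulnDr.
  (* The wedge factor is u: the exponent of x_j grows by d if j = J u. *)
  rewrite var_powE eq_sym (negbTE (nu j)) /=; lia.
(* The wedge factor is x_(J u)^d: for j = J u, the term f j of the induction
   hypothesis is available as this factor is missing from the rest. *)
rewrite (inj_eq (var_pow_inj d_gt0)).
rewrite [j == _]eq_sym; case: (eqVneq (J u) j) => [<-|_] /=; last by lia.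
rewrite vC; lia.
Qed.

Lemma denom_cons u s :
  denom (u :: s) = (mnm (@var_pow n d (J u)) + denom s)%MM.
Proof. by rewrite /denom big_cons. Qed.

(** Every replacement puts a pure power among the wedge factors, so the
    coefficient of e_s comes from the terms u (x) 1 alone. *)
Lemma swaps_lead s : liftable s -> uniq s ->
  exists e, swaps s [set u in s] = (-1) ^+ e * 'X_[denom s + f].
Proof.
elim: s => [|u s IH] hs /=.
  exists 0%N; rewrite ffunE expr0 mul1r /denom big_nil add0m.
  by rewrite (_ : [set u in [::]] = set0) ?eqxx //; apply/setP=> u; rewrite !inE.
case/andP=> us /IH[v vs|e IHe]; first by apply: hs; rewrite inE vs orbT.
exists (before u [set v in u :: s] + e)%N; rewrite swapE !wedge1XE !inE eqxx /=.
have Es : [set v in u :: s] :\ u = [set v in s].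
  apply/setP=> v; rewrite !inE; case: eqVneq => [->|//]; exact/esym/negbTE.
have /negbTE nv : var_pow (J u) \notin u :: s.
  by apply/negP=> /hs[/(_ (J u))]; rewrite var_powE eqxx mul1n ltnn.
rewrite inE in nv; rewrite nv mulr0 subr0 Es IHe denom_cons -addmA.
by rewrite [in RHS]mpolyXD exprD; ring.
Qed.

Definition lift (s : seq (monom n d)) : koszul k n d :=
  [ffun C : {set monom n d} => mnm_div (denom s) (swaps s C)].

Section LiftTheory.
Variable s : seq (monom n d).
Hypothesis hs : liftable s.

Lemma denom_le C : {in msupp (swaps s C), forall a, (denom s <= a)%MM}.
Proof.
move=> a ha; apply/mnm_lepP => j.
exact: leq_trans (leq_addr _ _) (swaps_divisible hs ha j).
Qed.

Lemma smul_lift : smul 'X_[denom s] (lift s) = swaps s.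
Proof.
by apply/ffunP=> C; rewrite !ffunE mnm_divK //; exact: denom_le.
Qed.

Lemma lift_chain : koszul_chain (size s) (mdeg f) (lift s).
Proof.
apply/forallP=> C; rewrite ffunE; have [hC zC] := swaps_homog s C.
case: ifPn => cC; last by rewrite zC ?mnm_div0.
by apply: mnm_div_homog; [exact: denom_le | rewrite mdeg_denom].
Qed.

(** S is a domain, so the denominator can be cancelled from the differential. *)
Lemma koszul_diff_lift : koszul_diff (lift s) = 0.
Proof.
have : smul 'X_[denom s] (koszul_diff (lift s)) = 0.
  by rewrite -koszul_diff_smul smul_lift koszul_diff_swaps.
move=> h; apply/ffunP=> C; have /ffunP/(_ C)/eqP := h; rewrite !ffunE.
by rewrite mulf_eq0 mpolyX_eq0 => /eqP.
Qed.

Lemma lift_lead : uniq s ->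
  exists e, lift s [set u in s] = (-1) ^+ e * 'X_[f].
Proof.
move=> us; have [e he] := swaps_lead hs us; exists e.
have X0 : ('X_[denom s] : S) != 0 by rewrite mpolyX_eq0.
apply: (mulfI X0); rewrite mulrCA -mpolyXD -he -smul_lift [in RHS]ffunE //.
Qed.

End LiftTheory.
End Lift.

(** The lift of e_A (x) f is a cycle.  To see that it is not the boundary of
    some w, compare the coefficients of e_A and of the monomial f: on the left
    it is a sign, while on the right u w_(A + u), for u outside A, involves f
    only if u divides f, which would put u in A. *)
Theorem koszul_cohomology_monomial (k : fieldType) (n d : nat) (b q : int)
    (f : 'X_{1..n.+1}) (A : {set monom n d}) :
    (0 < d)%N -> (mdeg f)%:Z = q * d%:Z + b ->
    (forall u, u \in A -> forall j, (mnm u j < d)%N) ->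
    (forall u, u \in A -> exists j, (d <= f j + mnm u j)%N) ->
    (forall u : monom n d, (mnm u <= f)%MM -> u \in A) ->
  exists x : koszul_cohomology k n d b #|A| q, x != 0.
Proof.
move=> d_gt0 deg_f nvA annA divA; apply/koszul_cohomology_neq0.
pose J (u : monom n d) := odflt ord0 [pick j | (d <= f j + mnm u j)%N].
have hs : liftable f J (enum A).
  move=> u; rewrite mem_enum => uA; split; first exact: nvA.
  rewrite /J; case: pickP => // no; have [j] := annA u uA; by rewrite no.
exists (lift f J (enum A)).
  apply/andP; split; last by rewrite koszul_diff_lift.
  by rewrite -deg_f cardE; exact: lift_chain.
case=> w _ /ffunP/(_ [set u in enum A]).
have [e ->] := lift_lead (k := k) d_gt0 hs (enum_uniq _).
rewrite (_ : [set u in enum A] = A); last by apply/setP=> u; rewrite inE mem_enum.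
rewrite ffunE => /(congr1 (mcoeff f))/eqP; rewrite raddf_sum big1 => [|m mA].
  rewrite -signr_odd; case: odd; rewrite ?expr0 ?mul1r ?expr1 ?mulN1r ?mcoeffN.
    by rewrite mcoeffX eqxx oppr_eq0 oner_eq0.
  by rewrite mcoeffX eqxx oner_eq0.
apply/eqP; rewrite mcoeff_eq0 mem_msupp_sign -mcoeff_eq0 mcoeffXM_eq0 //.
by apply: contra mA; exact: divA.
Qed.

(** * Counting divisors and annihilators *)

Section Counting.

Lemma card_between (T : finType) (D E : {set T}) (p : nat) :
  D \subset E -> (#|D| <= p <= #|E|)%N ->
  exists A : {set T}, [/\ D \subset A, A \subset E & #|A| = p].
Proof.
move=> DE /andP[Dp pE]; pose B := [set x in take (p - #|D|) (enum (E :\: D))].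
have BE : B \subset E :\: D.
  by apply/subsetP=> x; rewrite inE => /mem_take; rewrite mem_enum.
have cED : #|E :\: D| = (#|E| - #|D|)%N by rewrite cardsD (setIidPr DE).
have cB : #|B| = (p - #|D|)%N.
  rewrite cardsE; have /card_uniqP -> := take_uniq (p - #|D|) (enum_uniq (E :\: D)).
  rewrite size_takel // -cardE cED; lia.
exists (D :|: B); split; first exact: subsetUl.
  by rewrite subUset DE (subset_trans BE) ?subsetDl.
rewrite cardsU cB (_ : D :&: B = set0) ?cards0; first by lia.
apply/setP=> x; rewrite !inE; apply/negP=> /andP[xD xB].
by have /(subsetP BE) : x \in B; rewrite ?inE ?xD.
Qed.

(** Disjoint from the monomials counted on the left are the multiples of x_j^c,
    one for each monomial of degree d - c, and the s pure powers of the other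
    variables; x_j^d itself is one of the multiples. *)
Lemma card_bounded (s d c : nat) (j : 'I_s.+1) : (0 < c <= d)%N ->
  (#|[set v : monom s d | (mnm v j < c) && [forall i, mnm v i < d]]|
    + 'C(s + (d - c), s) + s <= 'C(s + d, s))%N.
Proof.
move=> /andP[c0 cd]; set X1 := [set v | _].
have hT (w : monom s (d - c)) : mdeg (mnm w + U_(j) *+ c)%MM = d.
  rewrite mdegD mdeg_mnm mdegMn mdeg1; lia.
pose X2 := [set to_monom (hT w) | w : monom s (d - c)].
pose X3 := [set @var_pow s d i | i in [set~ j]].
have d0 : (0 < d)%N by lia.
have c2 : #|X2| = 'C(s + (d - c), s).
  rewrite card_imset -?card_monom ?cardsT // => v w /(congr1 (@mnm _ _)).
  by rewrite !to_monomE => /addIm/mnm_inj.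
have c3 : #|X3| = s.
  by rewrite card_imset ?cardsC1 ?card_ord //; exact: var_pow_inj.
rewrite -c2 -[X in (_ + X <= _)%N]c3 -(card_monom (n := s) (d := d)).
have h12 : [disjoint X1 & X2].
  apply/pred0P=> v /=; apply/negP=> /andP[]; rewrite inE => /andP[vc _].
  case/imsetP=> w _ E; move: vc; rewrite E to_monomE mnmDE mulmnE mnm1E eqxx; lia.
have h123 : [disjoint X1 :|: X2 & X3].
  apply/pred0P=> v /=; apply/negP=> /andP[+ /imsetP[i ij E]].
  rewrite E !inE; move: ij; rewrite !inE => ij; case/orP.
    by case/andP=> _ /forallP/(_ i); rewrite var_powE eqxx mul1n ltnn.
  case/imsetP=> w _ /(congr1 (fun u => mnm u j)).
  rewrite var_powE to_monomE mnmDE mulmnE mnm1E eqxx (negbTE ij); lia.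
have := max_card (mem ((X1 :|: X2) :|: X3)).
by rewrite cardsU (disjoint_setI0 h123) cards0 cardsU (disjoint_setI0 h12) cards0
  !subn0.
Qed.

(** Transfers a count to the polynomial ring in the variables of the support:
    X lies in the image of the monomials in s + 1 variables with property P
    under the substitution x_i := x_(phi i). *)
Lemma card_supported (s n d : nat) (phi : 'I_s.+1 -> 'I_n.+1)
    (P : pred 'X_{1..s.+1}) (X : {set monom n d}) : injective phi ->
  (forall u l, u \in X -> l \notin codom phi -> mnm u l = 0%N) ->
  (forall u, u \in X -> P [multinom mnm u (phi i) | i < s.+1]) ->
  (#|X| <= #|[set v : monom s d | P (mnm v)]|)%N.
Proof.
move=> phi_inj X0 XP.
have hT (v : monom s d) : mdeg (\sum_i U_(phi i) *+ mnm v i)%MM = d.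
  rewrite mdeg_sum -[RHS](mdeg_mnm v) mdegE; apply: eq_bigr => i _.
  by rewrite mdegMn mdeg1 mul1n.
apply: leq_trans (leq_imset_card (fun v => to_monom (hT v)) _).
apply/subset_leq_card/subsetP => u uX; apply/imsetP.
have du : mdeg [multinom mnm u (phi i) | i < s.+1] = d.
  rewrite mdegE -[RHS](mdeg_mnm u) [RHS]mdegE.
  rewrite [RHS](bigID (mem (codom phi))) /= [X in (_ + X)%N]big1 ?addn0; last first.
    by move=> l; exact: X0.
  rewrite -big_uniq ?(map_inj_uniq phi_inj) ?enum_uniq // big_map big_enum.
  by apply: eq_bigr => i _; rewrite mnmE.
exists (to_monom du); first by rewrite inE to_monomE XP.
apply: mnm_inj; apply/mnmP=> l; rewrite !to_monomE mnm_sumE.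
case: (boolP (l \in codom phi)) => [/codomP[i ->]|ln].
  rewrite (bigD1 i) //= big1 ?addn0 => [|i' ii'].
    by rewrite mulmnE mnm1E eqxx mul1n mnmE.
  by rewrite mulmnE mnm1E (inj_eq phi_inj) (negbTE ii').
rewrite X0 // big1 // => i _; rewrite mulmnE mnm1E.
by case: eqP => // E; rewrite -E codom_f in ln.
Qed.

Lemma card_reduced (n d : nat) : (0 < d)%N ->
  (#|[set u : monom n d | [forall i, mnm u i < d]]| + n.+1 = 'C(n + d, n))%N.
Proof.
move=> d0; set X := [set u | _]; rewrite -card_monom -(cardsC X); congr (_ + _)%N.
rewrite -[LHS]card_ord -(card_imset _ (var_pow_inj (n := n) d0)).
apply: eq_card => u; rewrite !inE negb_forall.
apply/imsetP/existsP => [[i _ ->]|[i]].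
  by exists i; rewrite var_powE eqxx mul1n ltnn.
by rewrite -leqNgt => /var_powP ->; exists i.
Qed.

Section TopMonomial.
Variables (n d m r : nat).
Hypotheses (d_ge2 : (2 <= d)%N) (r_le : (r <= d - 2)%N).
(** The case m = n + 1 leaves no variable for the factor x_m^r, so that r = 0. *)
Hypothesis fits : (m + (0 < r) <= n.+1)%N.

Definition top_mnm : 'X_{1..n.+1} :=
  [multinom if (i < m)%N then d.-1 else ((i == m :> nat) * r)%N | i < n.+1].

Definition divisors := [set u : monom n d | (mnm u <= top_mnm)%MM].

Definition annihilators := [set u : monom n d |
  [forall i, mnm u i < d]%N && [exists j, d <= top_mnm j + mnm u j]%N].

Lemma mdeg_top_mnm : mdeg top_mnm = (m * d.-1 + r)%N.
Proof.
rewrite mdegE (eq_bigr (fun i : 'I_n.+1 => (if i < m then d.-1 else 0) +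
  (if i == m :> nat then r else 0)))%N => [|i _]; last first.
  by rewrite mnmE; case: ltngtP => _ //=; rewrite ?mul1n ?addn0.
rewrite big_split -!big_mkcond /=; congr (_ + _)%N.
  have mn : (m <= n.+1)%N by lia.
  by rewrite -(big_ord_widen _ (fun _ => d.-1) mn) sum_nat_const card_ord.
have [mn|mn] := ltnP m n.+1; last by rewrite big1 => [|i _]; lia.
by rewrite (big_pred1 (Ordinal mn)).
Qed.

Lemma top_mnm_at (l : 'I_n.+1) : l = m :> nat -> top_mnm l = r.
Proof. by move=> lm; rewrite mnmE lm ltnn eqxx mul1n. Qed.

Lemma top_mnm_lt j : (top_mnm j < d)%N.
Proof. by rewrite mnmE; case: ifP => _; [lia | case: (_ == m); lia]. Qed.

(** A divisor of degree d > r cannot be a power of x_m, so it involves some x_j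
    with j < m, whose exponent in f is d - 1. *)
Lemma divisors_sub_annihilators : divisors \subset annihilators.
Proof.
apply/subsetP=> u; rewrite !inE => /mnm_lepP uf; apply/andP; split.
  by apply/forallP=> j; apply: leq_ltn_trans (uf j) (top_mnm_lt j).
rewrite -[[exists _, _]]negbK negb_exists; apply/negP=> /forallP h.
have u0 (j : 'I_n.+1) : (mnm u j <= if j == m :> nat then r else 0)%N.
  move: (uf j) (h j); rewrite -ltnNge mnmE.
  by case: ltngtP => _ /=; rewrite ?mul0n ?mul1n //; lia.
have : (\sum_j mnm u j <= \sum_(j < n.+1 | j == m :> nat) r)%N.
  by rewrite [leqRHS]big_mkcond; apply: leq_sum => j _.
rewrite -mdegE mdeg_mnm; have [mn|mn] := ltnP m n.+1.
  by rewrite (big_pred1 (Ordinal mn)) //; lia.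
by rewrite big1 => [|i _]; lia.
Qed.

(** The divisors are the monomials in x_0, .., x_m, other than pure powers,
    where x_m has exponent at most r.  For m = n + 1 there is no x_m, and they
    are all monomials but the pure powers; Pascal's rule gives these the same
    formula. *)
Lemma card_divisors :
  (#|divisors| + 'C(m + (d - r.+1), m) + m <= 'C(m + d, m))%N.
Proof.
have lt_d u : u \in divisors -> forall i, (mnm u i < d)%N.
  by rewrite inE => /mnm_lepP uf i; apply: leq_ltn_trans (uf i) (top_mnm_lt i).
have [mn|mn] := leqP m n; last first.
  have [-> ->] : m = n.+1 /\ r = 0%N by lia.
  rewrite (_ : n.+1 + (d - 1) = n + d)%N ?addSn ?binS; last by lia.
  have d_gt0 : (0 < d)%N by lia.
  have := card_reduced n d_gt0.
  suff : divisors \subset [set u : monom n d | [forall i, mnm u i < d]%N].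
    move/subset_leq_card; lia.
  by apply/subsetP=> u /lt_d ud; rewrite inE; apply/forallP.
have mn' : (m.+1 <= n.+1)%N by [].
have r_lt : (0 < r.+1 <= d)%N by lia.
apply: leq_trans (card_bounded ord_max r_lt); rewrite !leq_add2r.
apply: (card_supported (phi := widen_ord mn') (P := fun a =>
  (a ord_max < r.+1)%N && [forall i, a i < d]%N)).
- by move=> i j /(congr1 val) /= /val_inj.
- move=> u l; rewrite inE => /mnm_lepP/(_ l) ul /negP nl.
  have [lm|ml] := ltnP l m.+1.
    by case: nl; apply/codomP; exists (Ordinal lm); apply: val_inj.
  by move: ul; rewrite mnmE; case: ltngtP ml => //= _ _; rewrite leqn0 => /eqP.
move=> u ud; apply/andP; split; last by apply/forallP=> i; rewrite mnmE lt_d.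
move: ud; rewrite inE mnmE => /mnm_lepP/(_ (widen_ord mn' ord_max)).
by rewrite top_mnm_at.
Qed.

(** A monomial that does not kill f involves none of x_0, .., x_(m-1), and has
    exponent less than d - r in x_m; these are counted with n - m + 1
    variables. *)
Lemma card_annihilators : (m <= n)%N ->
  ('C(n + d, n) + 'C(n - m + r, n - m) <=
     #|annihilators| + 'C(n - m + d, n - m) + m.+1)%N.
Proof.
move=> mn; have d_gt0 : (0 < d)%N by lia.
pose N := [set u : monom n d |
  [forall i, mnm u i < d]%N && [forall j, top_mnm j + mnm u j < d]%N].
have cN : (#|N| + 'C(n - m + r, n - m) + (n - m) <= 'C(n - m + d, n - m))%N.
  have r_lt : (0 < d - r <= d)%N by lia.
  have := card_bounded (ord0 : 'I_(n - m).+1) r_lt; rewrite subKn; last by lia.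
  apply: leq_trans; rewrite !leq_add2r.
  have hi (i : 'I_(n - m).+1) : (m + i < n.+1)%N by have := ltn_ord i; lia.
  apply: (card_supported (phi := fun i => Ordinal (hi i)) (P := fun a =>
    (a ord0 < d - r)%N && [forall i, a i < d]%N)).
  - by move=> i j /(congr1 val) /= /addnI /val_inj.
  - move=> u l; rewrite inE => /andP[_ /forallP/(_ l)]; rewrite mnmE.
    case: (ltnP l m) => [lm|lm] ul; first by move=> _; lia.
    have hl : (l - m < (n - m).+1)%N by have := ltn_ord l; lia.
    by case/negP; apply/codomP; exists (Ordinal hl); apply: val_inj; rewrite /= subnKC.
  move=> u; rewrite inE => /andP[/forallP ud /forallP/(_ (Ordinal (hi ord0)))].
  rewrite top_mnm_at ?[val _]addn0 // => u0.
  by apply/andP; split; [rewrite mnmE; lia | apply/forallP=> i; rewrite mnmE].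
have := card_reduced n d_gt0; set X := [set u | _].
have : X \subset annihilators :|: N.
  apply/subsetP=> u; rewrite !inE => ->; rewrite -[[exists _, _]]negbK negb_exists.
  rewrite (eq_forallb (fun j => esym (ltnNge _ _))).
  by case: [forall _, _].
move/subset_leq_card; rewrite cardsU; lia.
Qed.

Lemma card_annihilators_full : m = n.+1 ->
  ('C(n + d, n) <= #|annihilators| + n.+1)%N.
Proof.
move=> mE; rewrite -card_reduced ?leq_add2r; last by lia.
apply/subset_leq_card/subsetP=> u; rewrite !inE => ud; rewrite ud /=.
rewrite -[[exists _, _]]negbK negb_exists; apply/negP=> /forallP h.
have u0 (j : 'I_n.+1) : mnm u j = 0%N.
  have := h j; rewrite -ltnNge mnmE mE ltn_ord; lia.
have := mdeg_mnm u; rewrite mdegE big1 => [|i _]; [lia | exact: u0].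
Qed.

End TopMonomial.

End Counting.

(** * The nonvanishing range *)

Lemma binz_neg (a c : int) : c < 0 -> a != -1 \/ c != -1 -> binz a c = 0.
Proof. by case: c => // -[|c]; case: a => // -[|a] // _ []. Qed.

Theorem theorem2p1 (k : fieldType) (n d : nat) (b q m r : int)
    (d_ge2 : (2 <= d)%N)
    (b_ge0 : 0 <= b) (b_le : b <= d%:Z - 1)
    (q_ge0 : 0 <= q)
    (q_le : (q%:~R : rat) <= n%:R + 1 - (n%:R + b%:~R) / d%:R)
    (div_eq : q * d%:Z + b = m * (d%:Z - 1) + r)
    (r_ge0 : 0 <= r) (r_le : r <= d%:Z - 2)
    (p : int)
    (p_ge : binz (m + d%:Z) m - binz (m + d%:Z - r - 1) m - m <= p)
    (p_le : p <= binz (n%:Z + d%:Z) n%:Z + binz (n%:Z - m + r) (n%:Z - m)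
                 - binz (n%:Z - m + d%:Z) (n%:Z - m) - m - 1) :
  exists x : koszul_cohomology k n d b p q, x != 0.
Proof.
have m_ge0 : 0 <= m by nia.
case: r r_ge0 r_le div_eq p_ge p_le => // r _ r_le div_eq p_ge p_le.
case: m m_ge0 div_eq p_ge p_le => // m _ div_eq p_ge p_le.
have {r_le} r_le : (r <= d - 2)%N by lia.
have {}p_ge : 'C(m + d, m)%:Z - 'C(m + (d - r.+1), m)%:Z - m%:Z <= p.
  move: p_ge; rewrite (_ : m%:Z + d%:Z - r%:Z - 1 = (m + (d - r.+1))%N) //; lia.
have {}p_le : p <= 'C(n + d, n)%:Z + binz (n%:Z - m%:Z + r%:Z) (n%:Z - m%:Z)
    - binz (n%:Z - m%:Z + d%:Z) (n%:Z - m%:Z) - m%:Z - 1 by [].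
have [fits|nofit] := leqP (m + (0 < r)) n.+1; last first.
  (* There is no monomial f.  The lower bound is at least
     'C(m + d, m) - 'C(m - 1 + d, m) - m = 'C(m - 1 + d, m - 1) - m, hence at
     least 'C(n + d, n) - m, above the upper bound 'C(n + d, n) - m - 1. *)
  exfalso; move: p_le; rewrite !binz_neg; try lia.
  have mono : ('C(n + d, n) <= 'C(m.-1 + d, m.-1))%N.
    rewrite -(bin_sub (leq_addr d n)) -(bin_sub (leq_addr d m.-1)) !addKn.
    by apply: leq_bin2l; lia.
  have mono' : ('C(m + (d - r.+1), m) <= 'C(m.-1 + d, m))%N.
    by apply: leq_bin2l; lia.
  have := binS (m.-1 + d) m.-1; rewrite -addSn prednK; lia.
have sub := divisors_sub_annihilators d_ge2 r_le fits.
have cdiv := card_divisors d_ge2 r_le fits.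
have cann : p <= #|annihilators n d m r|.
  have [mn|mn] := leqP m n.
    have := card_annihilators d_ge2 r_le fits mn; move: p_le.
    rewrite (_ : n%:Z - m%:Z = (n - m)%N) /=; lia.
  have [mE r0] : m = n.+1 /\ r = 0%N by lia.
  have := card_annihilators_full d_ge2 r_le fits mE; move: p_le.
  (* Here the convention binz (-1) (-1) = 1 enters. *)
  have -> : n%:Z - m%:Z = -1 by lia.
  rewrite r0 addr0 [binz (-1 + d%:Z) _]binz_neg //=; lia.
have p_ge0 : 0 <= p by lia.
case: p p_ge0 p_ge p_le cann => // p _ p_ge p_le cann.
have [|A [divA annA <-]] := card_between (p := p) sub; first by lia.
have A_ann u : u \in A -> u \in annihilators n d m r by move/(subsetP annA).
apply: (@koszul_cohomology_monomial _ _ _ _ _ (top_mnm n d m r)).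
- lia.
- by rewrite mdeg_top_mnm //; nia.
- by move=> u /A_ann; rewrite inE => /andP[/forallP].
- by move=> u /A_ann; rewrite inE => /andP[_ /existsP].
by move=> u uf; apply: (subsetP divA); rewrite inE.
Qed.
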